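(* Let $m\ge 1$, $1\le p<\infty$, and let $U\subset F_B(\mathbb{R}^m)$. Then $U$ is totally bounded in $(F_B(\mathbb{R}^m), d_p)$ if and only if (i) $U$ is uniformly $p$-mean bounded; and (ii) $U$ is $p$-mean equi-left-continuous.
   Context: $H$ is the Hausdorff metric on nonempty closed subsets of $\mathbb{R}^m$ (Euclidean distance): $H(A,B)=\max\{\sup_{a\in A}\inf_{b\in B}d(a,b),\ \sup_{b\in B}\inf_{a\in A}d(a,b)\}$. A fuzzy set on $\mathbb{R}^m$ is a function $u:\mathbb{R}^m\to[0,1]$; its cuts are $[u]_\alpha=\{x: u(x)\ge\alpha\}$ for $\alpha\in(0,1]$ and $[u]_0=\overline{\{x: u(x)>0\}}$. $F_B(\mathbb{R}^m)$ is the set of fuzzy sets $u$ on $\mathbb{R}^m$ that are normal ($u(x_0)=1$ for some $x_0$), upper semi-continuous, and have $[u]_0$ bounded. The metric is $d_p(u,v)=\left(\int_0^1 H([u]_\alpha,[v]_\alpha)^p\,d\alpha\right)^{1/p}$. A set $U$ of such fuzzy sets is uniformly $p$-mean bounded if there is $M>0$ with $d_p(u,\widehat{0})\le M$ for all $u\in U$, where $\widehat 0$ is the characteristic function of $\{0\}$ ($0$ the origin). $U$ is $p$-mean equi-left-continuous if for every $\varepsilon>0$ there is $\delta>0$ such that for all $0\le h<\delta$ and all $u\in U$, $\left(\int_h^1 H([u]_\alpha,[u]_{\alpha-h})^p\,d\alpha\right)^{1/p}<\varepsilon$. *)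

(* Defs.v *)
From HB Require Import structures.
From mathcomp Require Import all_boot all_order all_algebra.
From mathcomp Require Import all_classical all_reals all_analysis.

Set Implicit Arguments.
Unset Strict Implicit.
Unset Printing Implicit Defensive.

Import Order.TTheory GRing.Theory Num.Theory.
Import numFieldNormedType.Exports.

Local Open Scope classical_set_scope.
Local Open Scope ring_scope.

(* The library's norm on 'rV[R]_m is the sup norm, so the Euclidean distance is
   defined here. Both norms give the same topology and the same bounded sets;
   [closure], [\near] and [bounded_set] below are the library's. *)
Definition euclidean_dist (R : realType) (m : nat) (x y : 'rV[R]_m) : R :=
  Num.sqrt (\sum_(i < m) (x ord0 i - y ord0 i) ^+ 2).

Definition hausdorff_dist (R : realType) (m : nat) (A B : set 'rV[R]_m) :
    \bar R :=
  maxe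
    (ereal_sup
       [set ereal_inf [set (euclidean_dist a b)%:E | b in B] | a in A])
    (ereal_sup
       [set ereal_inf [set (euclidean_dist a b)%:E | a in A] | b in B]).

(* The value for [a] outside [0, 1] is irrelevant. *)
Definition fuzzy_cut (R : realType) (m : nat) (u : 'rV[R]_m -> R) (a : R) :
    set 'rV[R]_m :=
  if a == 0 then closure [set x | 0 < u x] else [set x | a <= u x].

Definition fuzzy_set (R : realType) (m : nat) (u : 'rV[R]_m -> R) : Prop :=
  forall x, 0 <= u x <= 1.

Definition fuzzy_normal (R : realType) (m : nat) (u : 'rV[R]_m -> R) : Prop :=
  exists x0, u x0 = 1.

Definition upper_semicontinuous (R : realType) (T : topologicalType)
    (f : T -> R) : Prop :=
  forall x a, f x < a -> \forall y \near x, f y < a.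

Definition fuzzyB (R : realType) (m : nat) : set ('rV[R]_m -> R) :=
  [set u | [/\ fuzzy_set u, fuzzy_normal u, upper_semicontinuous u
             & bounded_set (fuzzy_cut u 0)]].

Arguments fuzzyB : clear implicits.

Definition dp (R : realType) (m : nat) (p : R) (u v : 'rV[R]_m -> R) : \bar R :=
  ((\int[lebesgue_measure]_(a in `[0%R, 1%R])
      (hausdorff_dist (fuzzy_cut u a) (fuzzy_cut v a) `^ p)) `^ p^-1)%E.

Definition fuzzy0 (R : realType) (m : nat) : 'rV[R]_m -> R :=
  \1_[set (0 : 'rV[R]_m)].

Arguments fuzzy0 : clear implicits.

Definition uniformly_p_mean_bounded (R : realType) (m : nat) (p : R)
    (U : set ('rV[R]_m -> R)) : Prop :=
  exists2 M : R, 0 < M & forall u, U u -> (dp p u (fuzzy0 R m) <= M%:E)%E.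

Definition p_mean_equi_left_continuous (R : realType) (m : nat) (p : R)
    (U : set ('rV[R]_m -> R)) : Prop :=
  forall e : R, 0 < e ->
    exists2 delta : R, 0 < delta &
      forall h : R, 0 <= h < delta -> forall u, U u ->
        ((\int[lebesgue_measure]_(a in `[h, 1%R])
            (hausdorff_dist (fuzzy_cut u a) (fuzzy_cut u (a - h)%R) `^ p)) `^ p^-1
          < e%:E)%E.

(* Total boundedness of [A] as a subset of the metric space [(X, d)]: finite
   e-nets have their points in [X]. *)
Definition totally_bounded_in (R : realType) (T : Type) (X : set T)
    (d : T -> T -> \bar R) (A : set T) : Prop :=
  forall e : R, 0 < e ->
    exists F : set T, [/\ finite_set F, F `<=` X
      & forall x, A x -> exists2 y, F y & (d x y < e%:E)%E].

(* Main.v *)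
Require Import Defs.
From mathcomp Require Import all_boot all_order all_algebra.
From mathcomp Require Import all_classical all_reals all_analysis.
From mathcomp Require Import measurable_realfun.
From mathcomp Require Import ring lra.

(* The proof rests on monotonicity: the cuts of a fuzzy set in F_B are nonempty,
   uniformly bounded and decreasing in the level.

   Necessity: by Minkowski's inequality it suffices that each single fuzzy set
   is p-mean left-continuous. Cut a bounded box into finitely many small cells:
   the set of cells met by a cut is a decreasing function of the level with
   values in a finite lattice, so it changes only a bounded number of times.

   Sufficiency: let h = 1/(n+1) be small. As the cuts are nested, rounding a
   level down to the grid {j h} moves the cut at level a by at most
   H([u]_a, [u]_(a - h)), which (ii) controls in mean for a >= h. Below h, the
   mean size of the cuts is compared, again through (ii), with that near a fixed
   level tau, and it is small there because (i) bounds the cut at level tau.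
   Above h all grid cuts lie in a common box, so recording which cells they meet
   sorts U into finitely many classes, each of small d_p-diameter; one
   representative per class gives the net. *)

Import Order.TTheory GRing.Theory Num.Theory.
Import numFieldNormedType.Exports.

Local Open Scope classical_set_scope.
Local Open Scope ring_scope.

(** * Hausdorff distance *)

Section euclidean.
Context {R : realType} {m : nat}.
Implicit Types (x y z : 'rV[R]_m) (A B C D : set 'rV[R]_m) (r s : R).

Local Notation d := (@euclidean_dist R m).

Lemma euclidean_distC x y : d x y = d y x.
Proof.
by congr Num.sqrt; apply: eq_bigr => i _; rewrite -sqrrN opprB.
Qed.

Lemma euclidean_distxx x : d x x = 0.
Proof.
by rewrite /euclidean_dist big1 ?sqrtr0// => i _; rewrite subrr expr0n.
Qed.

Lemma euclidean_dist_ge0 x y : 0 <= d x y.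
Proof. exact: sqrtr_ge0. Qed.

(** Lagrange's identity: the double sum of the squares of a_i b_j - a_j b_i is twice the difference
    of the two sides. *)
Lemma cauchy_schwarz_sum (I : finType) (a b : I -> R) :
  (\sum_i a i * b i) ^+ 2 <= (\sum_i a i ^+ 2) * (\sum_i b i ^+ 2).
Proof.
have : 0 <= \sum_i \sum_j (a i * b j - a j * b i) ^+ 2.
  by apply: sumr_ge0 => i _; apply: sumr_ge0 => j _; exact: sqr_ge0.
suff -> : \sum_i \sum_j (a i * b j - a j * b i) ^+ 2 =
    ((\sum_i a i ^+ 2) * (\sum_i b i ^+ 2) - (\sum_i a i * b i) ^+ 2) *+ 2.
  by rewrite pmulrn_lge0// subr_ge0.
rewrite expr2 !big_distrlr/= mulrnBl !mulr2n.
rewrite {2}(exchange_big _ _ _ _ _ (fun i j => a i ^+ 2 * b j ^+ 2))/=.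
rewrite -!big_split -sumrB; apply: eq_bigr => i _.
rewrite -!big_split -sumrB; apply: eq_bigr => j _ /=; ring.
Qed.

Lemma euclidean_dist_triangle x y z : d x z <= d x y + d y z.
Proof.
rewrite -ler_sqr ?nnegrE ?addr_ge0 ?euclidean_dist_ge0//.
rewrite sqrrD !sqr_sqrtr; try by apply: sumr_ge0 => i _; exact: sqr_ge0.
set a := fun i => x ord0 i - y ord0 i; set b := fun i => y ord0 i - z ord0 i.
have -> : \sum_(i < m) (x ord0 i - z ord0 i) ^+ 2 =
   \sum_i a i ^+ 2 + (\sum_i a i * b i) *+ 2 + \sum_i b i ^+ 2.
  rewrite -sumrMnl -!big_split; apply: eq_bigr => i _.
  by rewrite /a /b /=; ring.
rewrite lerD2r lerD2l lerMn2r/=.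
apply: (le_trans (ler_norm _)); rewrite -sqrtr_sqr -sqrtrM; last first.
  by apply: sumr_ge0 => i _; exact: sqr_ge0.
by rewrite ler_sqrt ?cauchy_schwarz_sum// mulr_ge0//; apply: sumr_ge0 => i _;
  exact: sqr_ge0.
Qed.

Lemma coord_le_euclidean_dist x y i : `|x ord0 i - y ord0 i| <= d x y.
Proof.
rewrite -sqrtr_sqr ler_sqrt; last by apply: sumr_ge0 => j _; exact: sqr_ge0.
rewrite (bigD1 i)//= lerDl; apply: sumr_ge0 => j _; exact: sqr_ge0.
Qed.

(** Since m < (m+1)^2, the divisor [m.+1] gives a strict bound, also for m = 0. *)
Lemma euclidean_dist_lt x y r : 0 < r ->
  (forall i, `|x ord0 i - y ord0 i| <= r / m.+1%:R) -> d x y < r.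
Proof.
move=> r0 xyr; rewrite -ltr_sqr ?nnegrE ?euclidean_dist_ge0 ?(ltW r0)//.
rewrite sqr_sqrtr; last by apply: sumr_ge0 => i _; exact: sqr_ge0.
apply: (@le_lt_trans _ _ (\sum_(i < m) (r / m.+1%:R) ^+ 2)).
  apply: ler_sum => i _; rewrite -real_normK ?num_real// ler_sqr ?nnegrE//.
  by rewrite divr_ge0// ltW.
rewrite sumr_const card_ord exprMn -mulrnAr gtr_pMr ?exprn_gt0//.
rewrite -mulr_natl exprVn ltr_pdivrMr ?exprn_gt0// mul1r -natrX ltr_nat.
by rewrite -mulnn mulSn addSn ltnS leq_addr.
Qed.

Definition within r A B := forall a, A a -> exists2 b, B b & d a b < r.

Lemma within_trans r s A B C :
  within r A B -> within s B C -> within (r + s) A C.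
Proof.
move=> AB BC a /AB[b /BC[c Cc bc] ab]; exists c => //.
by apply: le_lt_trans (euclidean_dist_triangle a b c) _; exact: ltrD.
Qed.

Lemma within_le r s A B : r <= s -> within r A B -> within s A B.
Proof. by move=> rs AB a /AB[b Bb ab]; exists b => //; exact: lt_le_trans rs. Qed.

Definition excess A B : \bar R :=
  ereal_sup [set ereal_inf [set (d a b)%:E | b in B] | a in A].

(** Infima need not be attained, so a nearby point exists only for radii strictly above x; letting r
    range over all of them recovers the bound, infinite x included. *)
Lemma excess_leP A B (x : \bar R) :
  (excess A B <= x)%E <-> forall r, (x < r%:E)%E -> within r A B.
Proof.
split=> [ABx r xr a Aa|h].
  have : (ereal_inf [set (d a b)%:E | b in B] < r%:E)%E.
    apply: le_lt_trans xr; apply: le_trans ABx.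
    by apply: ereal_sup_ubound; exists a.
  by move=> /ereal_inf_lt[_ [b Bb <-]]; rewrite lte_fin; exists b.
apply: ge_ereal_sup => _ [a Aa <-]; rewrite leNgt; apply/negP.
set y := ereal_inf _ => xy.
have [r xr ry] : exists2 r : R, (x < r%:E)%E & (r%:E <= y)%E.
  case: y xy => [y xy|xy|]; last by rewrite ltNge leNye.
  - by exists y.
  - case: x xy {h} => [x _|//|_]; last by exists 0; rewrite ?ltNyr ?leey.
    by exists (x + 1); rewrite ?leey// lte_fin ltrDl.
have [b Bb] := h _ xr _ Aa; apply/negP; rewrite -leNgt -lee_fin.
by apply: le_trans ry _; apply: ereal_inf_lbound; exists b.
Qed.

Lemma hausdorff_distE A B :
  hausdorff_dist A B = maxe (excess A B) (excess B A).
Proof.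
rewrite /hausdorff_dist /excess; congr (maxe _ (ereal_sup (_ @` _))).
apply/funext => b; congr ereal_inf.
by apply: eq_imagel => a _; rewrite euclidean_distC.
Qed.

Lemma hausdorff_leP A B (x : \bar R) : (hausdorff_dist A B <= x)%E <->
  forall r, (x < r%:E)%E -> within r A B /\ within r B A.
Proof.
rewrite hausdorff_distE ge_max; split=> [/andP[/excess_leP AB /excess_leP BA]|h].
  by move=> r xr; split; [exact: AB|exact: BA].
by apply/andP; split; apply/excess_leP => r /h[].
Qed.

Lemma hausdorff_distC A B : hausdorff_dist A B = hausdorff_dist B A.
Proof. by rewrite !hausdorff_distE maxC. Qed.

(** For two empty sets both suprema are -oo, hence the nonemptiness. *)
Lemma hausdorff_dist_ge0 A B : A !=set0 -> (0 <= hausdorff_dist A B)%E.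
Proof.
move=> [a Aa]; rewrite leNgt; apply/negP => AB.
have /hausdorff_leP/(_ 0 AB)[/(_ _ Aa)[b _]] := lexx (hausdorff_dist A B).
by rewrite ltNge euclidean_dist_ge0.
Qed.

Lemma hausdorff_dist_triangle A B C : A !=set0 -> B !=set0 ->
  (hausdorff_dist A C <= hausdorff_dist A B + hausdorff_dist B C)%E.
Proof.
move=> A0 B0; have := hausdorff_dist_ge0 B C B0; have := hausdorff_dist_ge0 A B A0.
move: (@hausdorff_leP A B) (@hausdorff_leP B C).
case: (hausdorff_dist A B) => [r||//]; case: (hausdorff_dist B C) => [s||] //;
  rewrite ?addye ?addey ?leey//.
move=> /(_ r%:E)[/(_ (lexx _)) AB _] /(_ s%:E)[/(_ (lexx _)) BC _] _ _.
apply/hausdorff_leP => t; rewrite -EFinD lte_fin => rst.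
(* Half of the slack goes to each of the two strict inequalities. *)
pose e := (t - (r + s)) / 2.
have e0 : 0 < e by rewrite divr_gt0// subr_gt0.
have [|AB1 BA1] := AB (r + e); first by rewrite lte_fin ltrDl.
have [|BC1 CB1] := BC (s + e); first by rewrite lte_fin ltrDl.
have te : (r + e) + (s + e) = t by rewrite /e; field.
split; rewrite -te; first exact: within_trans AB1 BC1.
by rewrite addrC; exact: within_trans CB1 BA1.
Qed.

(** As B is inside C, only points of C matter: each lies in D, hence near A, which is inside B. This
    controls the rounding of levels. *)
Lemma hausdorff_dist_nested A B C D : A !=set0 ->
  A `<=` B -> B `<=` C -> C `<=` D ->
  (hausdorff_dist B C <= hausdorff_dist A D)%E.
Proof.
move=> A0 AB BC CD; apply/hausdorff_leP => r ADr.
have /hausdorff_leP/(_ r ADr)[_ DA] := lexx (hausdorff_dist A D).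
split=> [b Bb|c /CD/DA[a /AB]]; last by exists a.
exists b; first exact: BC.
rewrite euclidean_distxx -lte_fin; apply: le_lt_trans ADr.
exact: hausdorff_dist_ge0.
Qed.

Lemma hausdorff_dist_set1 A B x : A !=set0 -> A `<=` B ->
  (hausdorff_dist A [set x] <= hausdorff_dist B [set x])%E.
Proof.
move=> [a Aa] AB; apply/hausdorff_leP => r Bxr.
have /hausdorff_leP/(_ r Bxr)[Bx xB] := lexx (hausdorff_dist B [set x]).
split=> [b /AB/Bx//|_ ->]; have [_ -> ax] := Bx _ (AB _ Aa).
by exists a => //; rewrite euclidean_distC.
Qed.

(** * Discretisation of a box into finitely many cells *)

Definition box r : set 'rV[R]_m := [set x | forall i, `|x ord0 i| <= r].

(** [Q A] is the set of cells of side e/(m+1) that A meets, so a subset of the box is recorded up to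
    e by finite data. Monotonicity of [Q] serves the counting argument for a single fuzzy set. *)
Lemma finite_cells r e : 0 < e -> exists (T : finType) (Q : set 'rV[R]_m -> {set T}),
  (forall A B, A `<=` B -> Q A \subset Q B) /\
  (forall A B, A `<=` box r -> B `<=` box r -> Q A = Q B ->
    (hausdorff_dist A B <= e%:E)%E).
Proof.
move=> e0; pose w := e / m.+1%:R.
have w0 : 0 < w by rewrite divr_gt0.
(* [L] is the largest cell index of a coordinate in the box; points outside may fall back on the
   default of [inord]. *)
pose L := Num.truncn ((r + r) / w).
pose q (x : 'rV[R]_m) : {ffun 'I_m -> 'I_L.+1} :=
  [ffun i => inord (Num.truncn ((x ord0 i + r) / w))].
have qP x y : box r x -> box r y -> q x = q y -> d x y < e.
  move=> bx by_ /ffunP qxy; apply: euclidean_dist_lt => // i.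
  have pos z : box r z -> 0 <= (z ord0 i + r) / w.
    move=> /(_ i); rewrite ler_norml => /andP[z1 z2].
    by rewrite divr_ge0 ?(ltW w0)// addrC -lerBlDl sub0r.
  have trL z : box r z -> (Num.truncn ((z ord0 i + r) / w) < L.+1)%N.
    move=> bz; rewrite ltnS; apply: le_truncn; rewrite ler_pM2r ?invr_gt0//.
    by rewrite lerD2r (le_trans (ler_norm _)).
  have := qxy i; rewrite !ffunE => /(congr1 val); rewrite /= !inordK ?trL// => E.
  have /andP[x1 x2] := truncn_itv (pos _ bx).
  have /andP[y1 y2] := truncn_itv (pos _ by_).
  rewrite E in x1 x2; set k := Num.truncn _ in x1 x2 y1 y2.
  rewrite ler_pdivlMr// in x1; rewrite ler_pdivlMr// in y1.
  rewrite ltr_pdivrMr// -natr1 mulrDl mul1r in x2.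
  rewrite ltr_pdivrMr// -natr1 mulrDl mul1r in y2.
  rewrite -/w ler_norml.
  by apply/andP; split; lra.
pose Q A : {set {ffun 'I_m -> 'I_L.+1}} :=
  [set c | `[< exists2 x, A x & q x = c >]]%SET.
exists _, Q; split=> [A B AB|].
  apply/fintype.subsetP => c; rewrite !inE => -[x Ax xc].
  by exists x => //; exact: AB.
have QW A B : A `<=` box r -> B `<=` box r -> Q A \subset Q B -> within e A B.
  move=> bA bB /fintype.subsetP QAB a Aa.
  have /QAB : q a \in Q A by rewrite !inE; exists a.
  rewrite !inE => -[b Bb ba]; exists b => //.
  by apply: qP; [exact: bA|exact: bB|].
move=> A B bA bB QAB; apply/hausdorff_leP => s; rewrite lte_fin => /ltW es.
by split; apply: (within_le _ _ _ _ es); apply: QW; rewrite ?QAB.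
Qed.

End euclidean.

(** * Measurability *)

Section measurability_of_hausdorff.
Context {R : realType} {m : nat}.

Lemma rat_row_dense (x : 'rV[R]_m) (r : R) : 0 < r ->
  exists c : 'rV[rat]_m, euclidean_dist x (map_mx ratr c) < r.
Proof.
move=> r0; have w0 : 0 < r / m.+1%:R by rewrite divr_gt0.
have H i : exists q : rat, `|x ord0 i - ratr q| <= r / m.+1%:R.
  have /rat_in_itvoo[q] : x ord0 i < x ord0 i + r / m.+1%:R by rewrite ltrDl.
  rewrite in_itv/= => /andP[q1 q2]; exists q.
  by rewrite distrC ger0_norm ?subr_ge0 1?ltW// ltrBlDl.
exists (\row_i projT1 (cid (H i))); apply: euclidean_dist_lt => // i.
by rewrite !mxE; case: cid.
Qed.

Definition antitone_on (D : set R) (K : R -> set 'rV[R]_m) :=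
  forall a b, D a -> D b -> a <= b -> K b `<=` K a.

(** The set where the excess exceeds t is a countable union of sets [I ck], indexed by a rational
    centre and a radius 1/(k+1). In each, the condition on [K] passes to lower levels of D and that
    on [L] to higher ones, so it is an interval. *)
Lemma excess_measurable (D : set R) (K L : R -> set 'rV[R]_m) :
  is_interval D -> antitone_on D K -> antitone_on D L ->
  measurable_fun D (fun a => excess (K a) (L a)).
Proof.
move=> iD aK aL; have mD := is_interval_measurable iD.
apply: (measurability _ (ErealGenOInfty.measurableE R)).
move=> _ [_ [t ->] <-].
pose I (ck : 'rV[rat]_m * nat) : set R := [set a | D a /\
  (exists2 x, K a x & euclidean_dist (map_mx ratr ck.1) x < ck.2.+1%:R^-1) /\
  forall y, L a y -> t + ck.2.+1%:R^-1 <= euclidean_dist (map_mx ratr ck.1) y].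
rewrite (_ : _ `&` _ = \bigcup_ck I ck); last first.
  apply/seteqP; split=> [a [Da /=]|a [[c k] _ [Da [[x Kx cx] Ly]]]].
    rewrite in_itv/= andbT => /ereal_sup_gt[_ [x Kx <-]] tx.
    (* The infimum is +oo when [L a] is empty; any t' above t then works. *)
    have [t' [tt' t'x]] : exists t' : R, t < t' /\
        forall y, L a y -> t' <= euclidean_dist x y.
      move: tx; set z := ereal_inf _ => tz.
      have lez y : L a y -> (z <= (euclidean_dist x y)%:E)%E.
        by move=> Ly; apply: ereal_inf_lbound; exists y.
      case: z tz lez => [z| |]//; rewrite ?lte_fin => tz lez.
        by exists z; split=> // y /lez.
      by exists (t + 1); split=> [|y /lez//]; rewrite ltrDl.
    (* With 1/(k+1) below half the gap, replacing x by a rational centre costs at most 1/(k+1) and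
       leaves a margin 1/(k+1) above t. *)
    have s0 : 0 < (t' - t) / 2 by rewrite divr_gt0// subr_gt0.
    have [k kt'] : exists k, k.+1%:R^-1 < (t' - t) / 2.
      exists (Num.truncn ((t' - t) / 2)^-1).
      rewrite -[X in _ < X]invrK ltf_pV2 ?posrE ?invr_gt0//.
      have /truncn_itv/andP[//] : 0 <= ((t' - t) / 2)^-1 by rewrite invr_ge0 ltW.
    have [|c cx] := rat_row_dense x k.+1%:R^-1; first by rewrite invr_gt0.
    exists (c, k) => //; split=> //; split=> [|y /t'x xy].
      by exists x => //; rewrite euclidean_distC.
    have := euclidean_dist_triangle x (map_mx ratr c) y.
    move: cx kt' xy => /=; set e := _^-1 => *; lra.
  split=> //=; rewrite in_itv/= andbT; apply/ereal_sup_gtP.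
  eexists; first by exists x.
  (* The gain 1/(k+1) - d(c, x) > 0 does not depend on y, so the infimum stays strictly above t. *)
  apply: (@lt_le_trans _ _ (t + k.+1%:R^-1 - euclidean_dist (map_mx ratr c) x)%:E).
    by rewrite lte_fin -addrA ltrDl subr_gt0.
  apply: le_ereal_inf_tmp => _ [y /Ly + <-]; rewrite lee_fin /=.
  have := euclidean_dist_triangle (map_mx ratr c) x y.
  by set e := _^-1 => *; lra.
apply: countable_bigcupT_measurable => [|[c k]]; first exact: countableP.
apply: is_interval_measurable => a b [Da [_ La]] [Db [[x Kx cx] _]] z /andP[az zb].
have Dz : D z by apply: (iD _ _ Da Db); rewrite az.
split=> //; split; first by exists x => //; exact: aK Kx.
by move=> y Ly; apply: La; exact: aL Ly.
Qed.

Lemma hausdorff_dist_measurable (D : set R) (K L : R -> set 'rV[R]_m) :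
  is_interval D -> antitone_on D K -> antitone_on D L ->
  measurable_fun D (fun a => hausdorff_dist (K a) (L a)).
Proof.
move=> iD aK aL; under eq_fun do rewrite hausdorff_distE.
by apply: measurable_maxe; exact: excess_measurable.
Qed.

Lemma antitone_measurable (D : set R) (f : R -> R) : is_interval D ->
  (forall a b, D a -> D b -> a <= b -> f b <= f a) -> measurable_fun D f.
Proof.
move=> iD af; have mD := is_interval_measurable iD.
apply: (measurability _ (RGenOInfty.measurableE R)).
move=> _ [_ [t ->] <-].
apply: is_interval_measurable => a b [Da _] [Db /=].
rewrite in_itv/= andbT => tb z /andP[az zb].
have Dz : D z by apply: (iD _ _ Da Db); rewrite az.
by split=> //=; rewrite in_itv/= andbT; apply: lt_le_trans tb _; exact: af.
Qed.

End measurability_of_hausdorff.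

(** * Lp seminorms on subsets of the line *)

Section pnorm.
Context {R : realType}.
Implicit Types (D E : set R) (f g : R -> \bar R).
Variables (p : R) (p1 : 1 <= p).

Local Notation mu := (@lebesgue_measure R).

Definition pnorm D f : \bar R := ((\int[mu]_(a in D) f a `^ p) `^ p^-1)%E.

(** Extended values with these properties are those of a real function, to which Minkowski's
    inequality applies. *)
Definition finite_nonneg_on D f := measurable_fun D f /\
  forall a, D a -> (0 <= f a)%E /\ f a \is a fin_num.

Let p0 : 0 < p. Proof. exact: lt_le_trans p1. Qed.

Lemma finite_nonneg_onD D f g : finite_nonneg_on D f -> finite_nonneg_on D g ->
  finite_nonneg_on D (fun a => f a + g a)%E.
Proof.
move=> [mf f0] [mg g0]; split; first exact: emeasurable_funD.
move=> a Da; have [? ?] := f0 _ Da; have [? ?] := g0 _ Da.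
by rewrite adde_ge0// fin_numD; split=> //; apply/andP.
Qed.

Lemma finite_nonneg_on_cst D (c : R) : 0 <= c ->
  finite_nonneg_on D (fun=> c%:E).
Proof. by move=> c0; split=> [|a Da]; rewrite ?lee_fin. Qed.

Lemma pnorm_ge0 D f : (0 <= pnorm D f)%E.
Proof. exact: poweR_ge0. Qed.

Lemma le_poweR (x y : \bar R) (r : R) : 0 <= r -> (0 <= x)%E -> (x <= y)%E ->
  (x `^ r <= y `^ r)%E.
Proof.
move=> r0 x0 xy.
by apply: gt0_ler_poweR; rewrite // in_itv/= ?leey ?x0//= ?(le_trans x0 xy).
Qed.

Lemma measurable_fun_poweR D f : measurable D -> measurable_fun D f ->
  measurable_fun D (fun a => f a `^ p)%E.
Proof. by move=> mD mf; exact: (measurableT_comp (measurable_poweR p)). Qed.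

Lemma le_pnorm D f g : measurable D -> finite_nonneg_on D f ->
  finite_nonneg_on D g -> (forall a, D a -> f a <= g a)%E ->
  (pnorm D f <= pnorm D g)%E.
Proof.
move=> mD [mf f0] [mg g0] fg; apply: le_poweR; first by rewrite invr_ge0 ltW.
  by apply: integral_ge0 => a _; exact: poweR_ge0.
apply: ge0_le_integral => //; try exact: measurable_fun_poweR.
  by move=> a _; exact: poweR_ge0.
by move=> a Da; apply: le_poweR; [exact: ltW|case: (f0 _ Da)|exact: fg].
Qed.

Lemma le_pnorm_subset D E f : measurable D -> measurable E -> D `<=` E ->
  finite_nonneg_on E f -> (pnorm D f <= pnorm E f)%E.
Proof.
move=> mD mE DE [mf f0]; apply: le_poweR; first by rewrite invr_ge0 ltW.
  by apply: integral_ge0 => a _; exact: poweR_ge0.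
apply: ge0_subset_integral => //; first exact: measurable_fun_poweR.
by move=> a _; exact: poweR_ge0.
Qed.

(** Extension by zero turns the integral over D into one over the line; p > 0 makes the p-th power
    vanish off D. *)
Lemma pnorm_Lnorm D f : finite_nonneg_on D f ->
  pnorm D f = 'N[mu]_p%:E[EFin \o ((fine \o f) \_ D)]%E.
Proof.
move=> [mf f0]; rewrite /pnorm unlock; congr (_ `^ _)%E; rewrite [LHS]integral_mkcond.
apply: eq_integral => a _ /=; rewrite /patch; case: ifPn => [/set_mem Da|_].
  by have [fa0 ffin] := f0 _ Da; rewrite -[in LHS](fineK ffin) ger0_norm ?fine_ge0.
by rewrite normr0 powR0 ?gt_eqF.
Qed.

Lemma pnormD D f g : measurable D -> finite_nonneg_on D f ->
  finite_nonneg_on D g ->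
  (pnorm D (fun a => f a + g a) <= pnorm D f + pnorm D g)%E.
Proof.
move=> mD f0 g0; rewrite !pnorm_Lnorm//; last exact: finite_nonneg_onD.
have mfine h : finite_nonneg_on D h -> measurable_fun setT ((fine \o h) \_ D).
  move=> [mh _]; apply/(measurable_restrictT _ mD).
  by apply: measurableT_comp mh; exact: fine_measurable.
apply: le_trans (@minkowski_EFin _ _ _ mu _ _ _ (mfine _ f0) (mfine _ g0) p1).
rewrite le_eqVlt; apply/orP; left; apply/eqP; apply: eq_Lnorm => a /=.
rewrite /patch; case: ifPn => [/set_mem Da|_]; last by rewrite addr0.
have [_ ffin] := f0.2 _ Da; have [_ gfin] := g0.2 _ Da.
by rewrite /= fineD.
Qed.

Lemma pnorm_triangle D f g h : measurable D -> finite_nonneg_on D f ->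
  finite_nonneg_on D g -> finite_nonneg_on D h ->
  (forall a, D a -> f a <= g a + h a)%E -> (pnorm D f <= pnorm D g + pnorm D h)%E.
Proof.
move=> mD f0 g0 h0 fgh; apply: le_trans (pnormD _ _ _ mD g0 h0).
by apply: le_pnorm => //; exact: finite_nonneg_onD.
Qed.

Lemma pnorm_cst x y (c : R) : x <= y -> 0 <= c ->
  pnorm `[x, y]%classic (fun=> c%:E) = (c * (y - x) `^ p^-1)%:E.
Proof.
move=> xy c0; rewrite /pnorm integral_cst//= lebesgue_measure_itv/= lte_fin.
rewrite -EFinB; case: ltP => [_|yx].
  rewrite -EFinM poweR_EFin powRM ?powR_ge0 ?subr_ge0//.
  by rewrite -powRrM divff ?gt_eqF// powRr1.
have -> : y = x by apply/eqP; rewrite eq_le xy yx.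
by rewrite mule0 subrr poweR0r ?powR0 ?mulr0// invr_neq0// gt_eqF.
Qed.

(** On the union f is at most the sum of its restrictions to D and E, so Minkowski's inequality
    applies even if D and E overlap. *)
Lemma pnorm_setU D E f : measurable D -> measurable E ->
  finite_nonneg_on (D `|` E) f ->
  (pnorm (D `|` E) f <= pnorm D f + pnorm E f)%E.
Proof.
move=> mD mE f0; have mU := measurableU _ _ mD mE.
have restr A : measurable A -> A `<=` D `|` E ->
    finite_nonneg_on (D `|` E) (f \_ A) /\ pnorm (D `|` E) (f \_ A) = pnorm A f.
  move=> mA AU; split.
    split; first by apply/measurable_restrict => //; apply: measurable_funS f0.1.
    move=> a Ua; have [? ?] := f0.2 _ Ua; rewrite /patch.
    by case: ifPn => _.
  congr (_ `^ _)%E; rewrite -[in RHS](setIidl AU) integral_mkcondl.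
  apply: eq_integral => a _; rewrite /patch; case: ifPn => //.
  by rewrite poweR0r ?gt_eqF.
have [Df <-] := restr _ mD (@subsetUl _ _ _).
have [Ef <-] := restr _ mE (@subsetUr _ _ _).
apply: pnorm_triangle => // a Ua; have [fa0 _] := f0.2 _ Ua.
rewrite /patch; case: Ua => [Da|Ea].
  by rewrite mem_set// leeDl//; case: ifPn.
by rewrite (mem_set Ea) leeDr//; case: ifPn.
Qed.

(** Both measures agree on half-open intervals, which determine Lebesgue measure. *)
Lemma lebesgue_measure_shift (h : R) (A : set R) : measurable A ->
  pushforward mu ((fun x : R => x - h) : measurableTypeR R -> measurableTypeR R) A = mu A.
Proof.
have msub : measurable_fun setT
    ((fun x : R => x - h) : measurableTypeR R -> measurableTypeR R).
  exact: measurable_funB.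
move=> mA; rewrite -(@lebesgue_measure_unique R
  (measure_function_pushforward__canonical__measure_function_Measure mu msub))//.
move=> _ [[a b] _ <-] /=.
rewrite /pushforward.
rewrite (_ : _ @^-1` _ = `]a + h, b + h]%classic); last first.
  by apply/seteqP; split=> x /=; rewrite !in_itv/= ltrBrDr lerBlDr.
rewrite !lebesgue_measure_itv/= !lte_fin ltrD2r.
by case: ifPn => // _; rewrite -!EFinD; congr (_%:E); ring.
Qed.

Lemma integral_shift (x y h : R) f : measurable_fun `[x - h, y - h]%classic f ->
  (forall a, `[x - h, y - h]%classic a -> (0 <= f a)%E) ->
  (\int[mu]_(a in `[x, y]) f (a - h)%R =
    \int[mu]_(a in `[(x - h)%R, (y - h)%R]) f a)%E.
Proof.
move=> mf f0.
have mphi : measurable_fun setT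
    ((fun a : R => a - h) : measurableTypeR R -> measurableTypeR R).
  exact: measurable_funB.
have -> : `[x, y]%classic =
    ((fun a : R => a - h) : measurableTypeR R -> measurableTypeR R) @^-1` `[x - h, y - h].
  by apply/seteqP; split=> z /=; rewrite !in_itv/= !lerD2r.
have f0' : {in `[x - h, y - h]%classic, forall a, (0 <= f a)%E}.
  by move=> z /[!inE]; exact: f0.
rewrite -[LHS](ge0_integral_pushforward mphi mu (measurable_itv _) mf f0').
by apply: eq_measure_integral => A mA _; exact: lebesgue_measure_shift.
Qed.

Lemma pnorm_shift (x y h : R) f : finite_nonneg_on `[x - h, y - h]%classic f ->
  pnorm `[x, y]%classic (fun a => f (a - h)) = pnorm `[x - h, y - h]%classic f.
Proof.
move=> [mf f0]; congr (_ `^ _)%E.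
rewrite (integral_shift _ _ _ (fun a => f a `^ p)%E)//.
  exact: measurable_fun_poweR.
by move=> a _; exact: poweR_ge0.
Qed.

End pnorm.

(** * Cuts of fuzzy sets *)

Section cuts.
Context {R : realType} {m : nat}.
Implicit Types (u v : 'rV[R]_m -> R) (A B : set 'rV[R]_m).

(** Coordinates differ by at most r + r; the extra 1 keeps the radius positive when r = 0. *)
Lemma hausdorff_dist_box (r : R) A B : 0 <= r -> A !=set0 -> B !=set0 ->
  A `<=` box r -> B `<=` box r ->
  (hausdorff_dist A B <= ((r + r + 1) * m.+1%:R)%:E)%E.
Proof.
move=> r0 [a0 Aa0] [b0 Bb0] Ar Br.
have dlt (x y : 'rV[R]_m) : box r x -> box r y ->
    euclidean_dist x y < (r + r + 1) * m.+1%:R.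
  move=> rx ry; apply: euclidean_dist_lt => [|i].
    by rewrite mulr_gt0// ltr_pwDr// addr_ge0.
  rewrite mulfK ?pnatr_eq0//; apply: le_trans (ler_normB _ _) _.
  by apply: le_trans (lerD (rx i) (ry i)) _; rewrite lerDl.
apply/hausdorff_leP => s; rewrite lte_fin => /ltW rs.
by split; apply: (within_le _ _ _ _ rs) => a; [exists b0|exists a0] => //;
  apply: dlt; [exact: Ar|exact: Br|exact: Br|exact: Ar].
Qed.

Lemma fuzzy_cut_subset u (a b : R) : 0 <= a -> a <= b ->
  fuzzy_cut u b `<=` fuzzy_cut u a.
Proof.
rewrite le_eqVlt => /predU1P[<- b0|a0 ab].
  rewrite /fuzzy_cut eqxx /=; case: eqVneq => [_|bn0 x /= bx].
    exact: subset_refl.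
  apply: subset_closure; apply: lt_le_trans bx.
  by rewrite lt_neqAle eq_sym bn0.
rewrite /fuzzy_cut !gt_eqF//; last exact: lt_le_trans ab.
by move=> x /=; exact: le_trans.
Qed.

(** The form in which membership in F_B enters the estimates; the cuts lie in the one at level 0, so
    one box holds them all. *)
Definition bounded_cuts u :=
  (forall a : R, 0 <= a <= 1 -> fuzzy_cut u a !=set0) /\
  exists2 r : R, 0 <= r & fuzzy_cut u 0 `<=` box r.

Lemma fuzzyB_bounded_cuts u : fuzzyB R m u -> bounded_cuts u.
Proof.
move=> [_ [x0 ux0] _ bu]; split.
  move=> a /andP[a0 a1]; exists x0; apply: (fuzzy_cut_subset _ _ 1) => //.
  by rewrite /fuzzy_cut oner_eq0 /= ux0.
have [r r0 ur] := pinfty_ex_gt0 bu; exists r; first exact: ltW.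
move=> x /ur xr i; apply: le_trans xr; rewrite [leRHS]mx_normrE.
by apply: (le_bigmax _ (fun ij : 'I_1 * 'I_m => `|x ij.1 ij.2|) (ord0, i)).
Qed.

Lemma fuzzy_cut0 (a : R) : 0 <= a <= 1 ->
  fuzzy_cut (fuzzy0 R m) a = [set 0].
Proof.
have E b : 0 <= b -> b < 1 -> [set x | b < fuzzy0 R m x] = [set 0].
  move=> b0 b1; apply/seteqP; split=> x /=; rewrite /fuzzy0 indicE.
    by case: (boolP (x \in _)) => [/set_mem//|_]; rewrite ltNge b0.
  by move=> ->; rewrite mem_set.
move=> /andP[a0 a1]; rewrite /fuzzy_cut; case: eqVneq => [_|an0].
  rewrite E//; apply/esym/closure_id; apply: accessible_closed_set1.
  by apply: hausdorff_accessible; exact: norm_hausdorff.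
have {an0}a0 : 0 < a by rewrite lt_neqAle eq_sym an0.
apply/seteqP; split=> x /=; rewrite /fuzzy0 indicE.
  by case: (boolP (x \in _)) => [/set_mem//|_]; rewrite leNgt a0.
by move=> ->; rewrite mem_set.
Qed.

Lemma bounded_cuts0 : bounded_cuts (fuzzy0 R m).
Proof.
split=> [a a01|]; first by rewrite fuzzy_cut0//; exists 0.
exists 0 => //; rewrite fuzzy_cut0 ?lexx//= => _ -> i.
by rewrite mxE normr0.
Qed.

(** The level maps s and t allow the same level, a level and its shift, or two shifted levels.
    Monotone cuts give measurability, a common box gives finiteness. *)
Lemma cut_finite_nonneg u v (D : set R) (s t : R -> R) :
  bounded_cuts u -> bounded_cuts v -> is_interval D ->
  (forall a, D a -> 0 <= s a <= 1) -> (forall a, D a -> 0 <= t a <= 1) ->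
  {homo s : a b / a <= b} -> {homo t : a b / a <= b} ->
  finite_nonneg_on D (fun a => hausdorff_dist (fuzzy_cut u (s a)) (fuzzy_cut v (t a))).
Proof.
move=> [u0 [r r0 ur]] [v0 [r' r'0 vr]] iD s01 t01 ms mt; split.
  apply: hausdorff_dist_measurable => // a b Da Db ab; apply: fuzzy_cut_subset.
  - by case/andP: (s01 _ Da).
  - exact: ms.
  - by case/andP: (t01 _ Da).
  - exact: mt.
move=> a Da; have sa := u0 _ (s01 _ Da); have ta := v0 _ (t01 _ Da).
have H0 := hausdorff_dist_ge0 _ (fuzzy_cut v (t a)) sa; split=> //.
rewrite ge0_fin_numE//.
have sbox : fuzzy_cut u (s a) `<=` box (r + r').
  move=> x /(fuzzy_cut_subset _ 0) xs i; apply: le_trans (ur x _ i) _.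
    by apply: xs => //; case/andP: (s01 _ Da).
  by rewrite lerDl.
have tbox : fuzzy_cut v (t a) `<=` box (r + r').
  move=> x /(fuzzy_cut_subset _ 0) xt i; apply: le_trans (vr x _ i) _.
    by apply: xt => //; case/andP: (t01 _ Da).
  by rewrite lerDr.
have := hausdorff_dist_box _ _ _ (addr_ge0 r0 r'0) sa ta sbox tbox.
by move=> /le_lt_trans; apply; exact: ltry.
Qed.

(* The finite set of cells met by the cut at level [a] grows as [a] decreases,
   so it changes at boundedly many levels; away from these levels the cuts at
   [a] and [a - h] are close, and the exceptional set is controlled by
   telescoping the integral of its cardinality. *)
Lemma bounded_cuts_left_continuous (p : R) u (e : R) : 1 <= p -> 0 < e ->
  bounded_cuts u -> exists2 delta : R, 0 < delta <= 1 &
    forall h : R, 0 <= h < delta ->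
      (pnorm p `[h, 1%R]%classic (fun a =>
         hausdorff_dist (fuzzy_cut u a) (fuzzy_cut u (a - h))) < e%:E)%E.
Proof.
move=> p1 e0 bu; have [u0 [r r0 ur]] := bu.
have p0 : 0 < p by exact: lt_le_trans p1.
have eta0 : 0 < e / 2 by rewrite divr_gt0.
have [T [Q [Qmono Qclose]]] := @finite_cells R m r _ eta0.
(* [N a] counts the cells met at level a and is antitone; [C] bounds the p-th power of the distance
   between any two cuts. *)
pose N a : R := #|Q (fuzzy_cut u a)|%:R.
pose C : R := ((r + r + 1) * m.+1%:R) `^ p.
have C0 : 0 <= C by exact: powR_ge0.
have ep : (e / 2) `^ p < e `^ p.
  by rewrite gt0_ltr_powR ?nnegrE ?ltW// ltr_pdivrMr// ltr_pMr// ltr1n.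
pose K : R := C * #|T|%:R + 1.
have K0 : 0 < K by rewrite ltr_wpDl// mulr_ge0.
(* This makes (e/2)^p + C #|T| h < e^p; the 1 in [K] makes it positive. *)
exists (Num.min 1 ((e `^ p - (e / 2) `^ p) / K)).
  by rewrite lt_min ltr01 divr_gt0 ?subr_gt0// ge_min lexx.
move=> h /andP[h0]; rewrite lt_min => /andP[h1]; rewrite ltr_pdivlMr// => hK.
have mN (D : set R) (s : R -> R) : is_interval D -> {homo s : a b / a <= b} ->
    (forall a, D a -> 0 <= s a) -> measurable_fun D (fun a => (C * N (s a))%:E).
  move=> iD ms s0; apply/measurable_EFinP; apply: measurable_funM => //.
  apply: antitone_measurable => // a b Da _ ab; rewrite ler_nat.
  by apply: subset_leq_card; apply: Qmono; apply: fuzzy_cut_subset; [exact: s0|exact: ms].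
have NC0 a : (0 <= (C * N a)%:E)%E by rewrite lee_fin mulr_ge0.
have NCT a : C * N a <= C * #|T|%:R by rewrite ler_wpM2l// ler_nat max_card.
have box01 a : 0 <= a -> fuzzy_cut u a `<=` box r.
  by move=> a0; apply: subset_trans ur; exact: fuzzy_cut_subset.
set D := `[h, 1]%classic.
have mD : measurable D by exact: measurable_itv.
have D1 a : D a -> h <= a <= 1 by rewrite /D /= in_itv.
have iD : is_interval D by exact: interval_is_interval.
have H0 : finite_nonneg_on D (fun a =>
    hausdorff_dist (fuzzy_cut u a) (fuzzy_cut u (a - h))).
  apply: cut_finite_nonneg => //.
  - by move=> a /D1/andP[? ?]; apply/andP; split; lra.
  - by move=> a /D1/andP[? ?]; apply/andP; split; lra.
  - by move=> a b; rewrite lerD2r.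
set I := (\int[lebesgue_measure]_(a in D)
  (hausdorff_dist (fuzzy_cut u a) (fuzzy_cut u (a - h)%R) `^ p))%E.
set J := (\int[lebesgue_measure]_(a in D) (C * N a)%:E)%E.
(* Pointwise, H^p + C N(a) <= (e/2)^p + C N(a - h): either the cells agree and H <= e/2, or N grows
   by at least 1 and pays for C. Keeping [J] on both sides avoids a subtraction of extended
   reals. *)
have IJ : (I + J <= ((e / 2) `^ p)%:E + (((C * #|T|%:R) * h)%:E + J))%E.
  have mI : measurable_fun D (fun a =>
      hausdorff_dist (fuzzy_cut u a) (fuzzy_cut u (a - h)%R) `^ p)%E.
    by apply: measurable_fun_poweR => //; case: H0.
  have mNh : measurable_fun D (fun a => (C * N (a - h))%:E).
    apply: mN => // [a b|a /D1/andP[]]; first by rewrite lerD2r.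
    by rewrite subr_ge0.
  have mN1 : measurable_fun D (fun a => (C * N a)%:E).
    by apply: mN => // a /D1/andP[ha _]; exact: le_trans ha.
  have mN01 : measurable_fun (`[0, 1]%classic : set R) (fun a => (C * N a)%:E).
    apply: mN => //; first exact: interval_is_interval.
    by move=> a /=; rewrite in_itv/= => /andP[].
  apply: (@le_trans _ _ (\int[lebesgue_measure]_(a in D)
      (((e / 2) `^ p)%:E + (C * N (a - h)%R)%:E))%E).
    rewrite -ge0_integralD//; last by move=> a _; exact: poweR_ge0.
    apply: ge0_le_integral => //.
    - by move=> a _; rewrite adde_ge0// poweR_ge0.
    - exact: emeasurable_funD.
    - exact: emeasurable_funD.
    move=> a /D1/andP[ha a1]; have a0 : 0 <= a - h by rewrite subr_ge0.
    have a01 : 0 <= a by exact: le_trans ha.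
    have aha : a - h <= a by rewrite gerBl.
    have sub : Q (fuzzy_cut u a) \subset Q (fuzzy_cut u (a - h)).
      by apply: Qmono; exact: fuzzy_cut_subset.
    have ne : fuzzy_cut u a !=set0 by apply: u0; rewrite a01.
    have ne' : fuzzy_cut u (a - h) !=set0 by apply: u0; rewrite a0 (le_trans aha).
    have Ha0 := hausdorff_dist_ge0 _ (fuzzy_cut u (a - h)) ne.
    (* Nested cell sets of equal size coincide. *)
    have [NN|NN] := leqP #|Q (fuzzy_cut u (a - h))| #|Q (fuzzy_cut u a)|.
      have QQ : Q (fuzzy_cut u a) = Q (fuzzy_cut u (a - h)).
        by apply/eqP; rewrite eqEcard sub.
      rewrite /N QQ leeD2r// -poweR_EFin le_poweR ?(ltW p0)//.
      by apply: Qclose => //; exact: box01.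
    apply: (@le_trans _ _ (C%:E + (C * N a)%:E)%E).
      rewrite leeD2r// -poweR_EFin le_poweR ?(ltW p0)//.
      by apply: hausdorff_dist_box => //; exact: box01.
    rewrite -!EFinD lee_fin; apply: (@le_trans _ _ (C * N (a - h))).
      by rewrite -{1}(mulr1 C) -mulrDr ler_wpM2l// addrC natr1 ler_nat.
    by rewrite lerDr powR_ge0.
  rewrite ge0_integralD//; last by move=> a _; rewrite lee_fin powR_ge0.
  apply: leeD.
    rewrite integral_cst//= lebesgue_measure_itv/= lte_fin; case: ifPn => _.
      by rewrite -EFinD -EFinM lee_fin ler_piMr ?powR_ge0// gerBl.
    by rewrite mule0 lee_fin powR_ge0.
  (* Translation turns the integral into one over [0, 1 - h], at most that over [0, h[ plus [J]. *)
  rewrite (integral_shift h 1 h (fun a => (C * N a)%:E)) ?subrr//; last first.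
    apply: measurable_funS mN01 => //.
    by apply: subset_itvl; rewrite bnd_simp gerBl.
  apply: (@le_trans _ _ (\int[lebesgue_measure]_(a in `[0%R, 1%R]) (C * N a)%:E)%E).
    apply: ge0_subset_integral => //; apply: subset_itvl.
    by rewrite bnd_simp gerBl.
  have U01 : (`[0, 1]%classic : set R) = `[0, h[%classic `|` D.
    by rewrite /D -itv_bndbnd_setU// bnd_simp// ltW.
  rewrite U01 ge0_integral_setU//; last 2 first.
  - by rewrite -U01.
  - rewrite disj_set2E; apply/eqP/seteqP; split=> // a [/=].
    by rewrite in_itv/= => /andP[_ ah] /D1/andP[]; rewrite leNgt ah.
  rewrite leeD2r//.
  apply: (@le_trans _ _ (\int[lebesgue_measure]_(a in `[0%R, h[)
      (C * #|T|%:R)%:E)%E).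
    apply: ge0_le_integral => // [|a _]; last by rewrite lee_fin.
    apply: measurable_funS mN01 => //.
    by apply: subset_itvl; rewrite bnd_simp ltW.
  rewrite integral_cst//= lebesgue_measure_itv/= lte_fin; case: ifPn => _.
    by rewrite -EFinD -EFinM subr0.
  by rewrite mule0 lee_fin !mulr_ge0.
(* Finiteness of [J] allows its cancellation. *)
have Jfin : J \is a fin_num.
  rewrite ge0_fin_numE ?integral_ge0//.
  apply: (@le_lt_trans _ _ (\int[lebesgue_measure]_(a in D)
      (C * #|T|%:R)%:E)%E).
    apply: ge0_le_integral => // [|a _]; last by rewrite lee_fin.
    by apply: mN => // a /D1/andP[ha _]; exact: le_trans ha.
  by rewrite integral_cst//= lebesgue_measure_itv/= lte_fin h1 -EFinD -EFinM ltry.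
have {}IJ : (I <= ((e / 2) `^ p + C * #|T|%:R * h)%:E)%E.
  by move: IJ; rewrite [leRHS]addeA -EFinD leeD2rE.
apply: (@le_lt_trans _ _ (((e / 2) `^ p + C * #|T|%:R * h) `^ p^-1)%:E).
  rewrite -poweR_EFin; apply: le_poweR => //; first by rewrite invr_ge0 ltW.
  by apply: integral_ge0 => a _; exact: poweR_ge0.
have -> : e%:E = ((e `^ p) `^ p^-1)%:E
  by congr _%:E; rewrite -powRrM divff ?gt_eqF// powRr1// ltW.
rewrite lte_fin gt0_ltr_powR ?invr_gt0 ?nnegrE ?powR_ge0//.
  by rewrite addr_ge0 ?powR_ge0// !mulr_ge0.
by move: hK; rewrite /K mulrDr mulr1 (mulrC h) => ?; lra.
Qed.

End cuts.

(** * Total boundedness *)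

(** The property holds for all h below a threshold, so the least of finitely many thresholds serves
    all x. *)
Lemma finite_uniform_pos (R : realType) (T : choiceType) (F : set T)
    (P : T -> R -> Prop) : finite_set F ->
  (forall x, F x -> exists2 d : R, 0 < d & forall h, h < d -> P x h) ->
  exists2 d : R, 0 < d & forall x, F x -> forall h, h < d -> P x h.
Proof.
move=> /finite_seqP[s ->]; elim: s => [_|x s IHs sP]; first by exists 1.
have [d1 d10 xP] : exists2 d : R, 0 < d & forall h, h < d -> P x h.
  by apply: sP; rewrite /= inE eqxx.
have [y ys|d2 d20 {}sP] := IHs; first by apply: sP; rewrite /= inE ys orbT.
exists (Num.min d1 d2); first by rewrite lt_min d10.
move=> y /=; rewrite inE => /predU1P[->|ys] h; rewrite lt_min => /andP[h1 h2].
  exact: xP.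
exact: sP h2.
Qed.

(** One representative is taken from each nonempty fibre of [f], so the centres lie in [A]
    itself. *)
Lemma finite_net (T : choiceType) (C : finType) (A : set T) (f : T -> C)
    (P : T -> T -> Prop) : (forall x y, A x -> A y -> f x = f y -> P x y) ->
  exists F : set T, [/\ finite_set F, F `<=` A
    & forall x, A x -> exists2 y, F y & P x y].
Proof.
move=> fP; have [[x0 Ax0]|A0] := pselect (A !=set0); last first.
  by exists set0; split=> // x Ax; case: A0; exists x.
pose g c := xget x0 [set x | A x /\ f x = c].
have gP x : A x -> A (g (f x)) /\ f (g (f x)) = f x.
  move=> Ax; have xA : exists y, A y /\ f y = f x by exists x.
  by have := xgetPex x0 xA.
exists (g @` (f @` A)); split.
- exact/finite_image/finite_finset.
- by move=> _ [_ [x Ax <-] <-]; case: (gP _ Ax).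
- move=> x Ax; exists (g (f x)); first by exists (f x) => //; exists x.
  by have [? ?] := gP _ Ax; apply: fP.
Qed.

Section dp.
Context {R : realType} {m : nat}.
Variables (p : R) (p1 : 1 <= p).
Implicit Types (u v w : 'rV[R]_m -> R).

Local Notation hd := (@hausdorff_dist R m).
Local Notation cut := (@fuzzy_cut R m).
Local Notation fz := (fuzzy0 R m).
Local Notation I01 := (`[0%R, 1%R]%classic : set R).

Let p0 : 0 < p. Proof. exact: lt_le_trans p1. Qed.

Lemma dpE u v : dp p u v = pnorm p I01 (fun a => hd (cut u a) (cut v a)).
Proof. by []. Qed.

Lemma dpC u v : dp p u v = dp p v u.
Proof. by rewrite !dpE; congr pnorm; apply/funext => a; exact: hausdorff_distC. Qed.

Lemma itv_sub01 (x y : R) : 0 <= x -> y <= 1 -> (`[x, y]%classic : set R) `<=` I01.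
Proof. by move=> x0 y1; apply: subset_itv; rewrite bnd_simp. Qed.

Lemma cuts_finite_nonneg u v (x y : R) : bounded_cuts u -> bounded_cuts v ->
  0 <= x -> y <= 1 ->
  finite_nonneg_on `[x, y]%classic (fun a => hd (cut u a) (cut v a)).
Proof.
move=> bu bv x0 y1; apply: cut_finite_nonneg => //.
- exact: interval_is_interval.
- by move=> a /=; rewrite in_itv/= => /andP[? ?]; apply/andP; split; lra.
- by move=> a /=; rewrite in_itv/= => /andP[? ?]; apply/andP; split; lra.
Qed.

Lemma shifted_cuts_finite_nonneg u v (h x y : R) : bounded_cuts u ->
  bounded_cuts v -> 0 <= h -> h <= x -> y <= 1 ->
  finite_nonneg_on `[x, y]%classic (fun a => hd (cut u a) (cut v (a - h))).
Proof.
move=> bu bv h0 hx y1; apply: cut_finite_nonneg => //.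
- exact: interval_is_interval.
- by move=> a /=; rewrite in_itv/= => /andP[? ?]; apply/andP; split; lra.
- by move=> a /=; rewrite in_itv/= => /andP[? ?]; apply/andP; split; lra.
- by move=> a b; rewrite lerD2r.
Qed.

Lemma dp_triangle u v w : bounded_cuts u -> bounded_cuts v -> bounded_cuts w ->
  (dp p u w <= dp p u v + dp p v w)%E.
Proof.
move=> bu bv bw; rewrite !dpE; apply: pnorm_triangle => //;
  try exact: cuts_finite_nonneg.
move=> a /=; rewrite in_itv/= => a01; apply: hausdorff_dist_triangle.
  exact: bu.1.
exact: bv.1.
Qed.

Lemma dp_fuzzy0_fin u : bounded_cuts u -> exists2 c : R, 0 <= c & dp p u fz = c%:E.
Proof.
move=> bu; have bO := @bounded_cuts0 R m.
(* On a one-point interval this says that the distance at level 0 is finite; by monotonicity it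
   dominates those at the other levels. *)
have f0 : finite_nonneg_on `[0, 0]%classic (fun a => hd (cut u a) (cut fz a)).
  exact: cuts_finite_nonneg.
have [|h0 hfin] := f0.2 0; first by rewrite /= in_itv/= lexx.
suff : (dp p u fz < +oo)%E.
  move: (pnorm_ge0 p I01 (fun a => hd (cut u a) (cut fz a))); rewrite -dpE.
  by case: (dp p u fz) => // c c0 _; exists c.
apply: (@le_lt_trans _ _ (pnorm p I01 (fun=> (fine (hd (cut u 0) (cut fz 0)))%:E))).
  rewrite dpE; apply: le_pnorm => //; first exact: cuts_finite_nonneg.
    by apply: finite_nonneg_on_cst; rewrite fine_ge0.
  move=> a /=; rewrite in_itv/= => a01; rewrite fineK//.
  rewrite !fuzzy_cut0 ?lexx ?ler01//; apply: hausdorff_dist_set1; first exact: bu.1.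
  by apply: fuzzy_cut_subset => //; case/andP: a01.
by rewrite pnorm_cst// ?fine_ge0// ltry.
Qed.

(** * Necessity of (i) and (ii) *)

Lemma totally_bounded_p_mean_bounded (U : set ('rV[R]_m -> R)) :
  U `<=` fuzzyB R m -> totally_bounded_in (fuzzyB R m) (dp p) U ->
  uniformly_p_mean_bounded p U.
Proof.
move=> UB /(_ 1 ltr01)[F [finF FB UF]].
(* Reciprocals turn a common upper bound over the finite net into a common positive threshold. *)
have [d d0 Fd] : exists2 d : R, 0 < d & forall v, F v -> forall h, h < d ->
    0 < h -> (dp p v fz <= (h^-1)%:E)%E.
  apply: finite_uniform_pos => // v /FB/fuzzyB_bounded_cuts/dp_fuzzy0_fin[c c0 ->].
  exists (c + 1)^-1; first by rewrite invr_gt0 ltr_wpDl.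
  move=> h hc h0; rewrite lee_fin; apply: (@le_trans _ _ (c + 1)); first by rewrite lerDl.
  by rewrite -[leLHS]invrK lef_pV2 ?posrE ?invr_gt0 ?ltW// ltr_wpDl.
(* Net radius 1 plus the bound at h = d/2. *)
exists (1 + (d / 2)^-1); first by rewrite ltr_wpDr// invr_ge0 divr_ge0// ltW.
move=> u Uu; have [v Fv uv] := UF _ Uu.
have bu := fuzzyB_bounded_cuts _ (UB _ Uu); have bv := fuzzyB_bounded_cuts _ (FB _ Fv).
apply: le_trans (dp_triangle _ _ _ bu bv bounded_cuts0) _.
rewrite EFinD; apply: leeD; first exact: ltW.
apply: Fd => //.
  by rewrite ltr_pdivrMr// ltr_pMr// ltr1n.
by rewrite divr_gt0.
Qed.

Lemma totally_bounded_equi_left_continuous (U : set ('rV[R]_m -> R)) :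
  U `<=` fuzzyB R m -> totally_bounded_in (fuzzyB R m) (dp p) U ->
  p_mean_equi_left_continuous p U.
Proof.
move=> UB tbU e e0; have e3 : 0 < e / 3 by rewrite divr_gt0.
have [F [finF FB UF]] := tbU _ e3.
have [d d0 Fd] : exists2 d : R, 0 < d & forall v, F v -> forall h, h < d ->
    0 <= h -> h <= 1 /\ (pnorm p `[h, 1%R]%classic
      (fun a => hd (cut v a) (cut v (a - h))) < (e / 3)%:E)%E.
  apply: finite_uniform_pos => // v /FB/fuzzyB_bounded_cuts bv.
  have [d /andP[d0 d1] dP] := bounded_cuts_left_continuous p v _ p1 e3 bv.
  exists d => // h hlt h0; split; first by rewrite ltW// (lt_le_trans hlt).
  by apply: dP; rewrite h0.
exists d => // h /andP[h0 hlt] u Uu; have [v Fv uv] := UF _ Uu.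
have [h1 vh] := Fd _ Fv _ hlt h0.
have bu := fuzzyB_bounded_cuts _ (UB _ Uu); have bv := fuzzyB_bounded_cuts _ (FB _ Fv).
set D := `[h, 1]%classic.
have D1 a : D a -> h <= a <= 1 by rewrite /D /= in_itv.
rewrite -/(pnorm p D (fun a => hd (cut u a) (cut u (a - h)))).
have mD : measurable D by exact: measurable_itv.
have fuv : finite_nonneg_on D (fun a => hd (cut u a) (cut v a)).
  exact: cuts_finite_nonneg.
have fvv : finite_nonneg_on D (fun a => hd (cut v a) (cut v (a - h))).
  exact: shifted_cuts_finite_nonneg.
have fuu : finite_nonneg_on D (fun a => hd (cut u a) (cut u (a - h))).
  exact: shifted_cuts_finite_nonneg.
have fvu : finite_nonneg_on D (fun a => hd (cut v (a - h)) (cut u (a - h))).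
  apply: cut_finite_nonneg => //; first exact: interval_is_interval.
  - by move=> a /D1 /andP[? ?]; apply/andP; split; lra.
  - by move=> a /D1 /andP[? ?]; apply/andP; split; lra.
  - by move=> a b; rewrite lerD2r.
  - by move=> a b; rewrite lerD2r.
have uv1 : (pnorm p D (fun a => hd (cut u a) (cut v a)) < (e / 3)%:E)%E.
  apply: le_lt_trans uv; rewrite dpE; apply: le_pnorm_subset => //.
    exact: itv_sub01.
  exact: cuts_finite_nonneg.
(* Translation by h brings this term to [0, 1 - h], where it is at most d_p(v, u). *)
have uv2 : (pnorm p D (fun a => hd (cut v (a - h)) (cut u (a - h))) < (e / 3)%:E)%E.
  rewrite dpC in uv; apply: le_lt_trans uv; rewrite dpE.
  have fvu1 : finite_nonneg_on `[h - h, 1 - h]%classic (fun a => hd (cut v a) (cut u a)).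
    by apply: cuts_finite_nonneg; rewrite ?subrr// gerBl.
  rewrite (pnorm_shift p h 1 h _ fvu1).
  apply: le_pnorm_subset => //; last exact: cuts_finite_nonneg.
  by apply: itv_sub01; rewrite ?subrr// gerBl.
(* The path goes from [u]_a to [v]_a, then to [v]_(a - h), then to [u]_(a - h). *)
apply: (@le_lt_trans _ _ (pnorm p D (fun a => hd (cut u a) (cut v a)) +
    (pnorm p D (fun a => hd (cut v a) (cut v (a - h))) +
     pnorm p D (fun a => hd (cut v (a - h)) (cut u (a - h)))))%E).
  apply: le_trans; last by apply: leeD2l; exact: pnormD.
  apply: pnorm_triangle => //; first exact: finite_nonneg_onD.
  move=> a /D1/andP[ha a1].
  have ua : cut u a !=set0 by apply: bu.1; rewrite (le_trans h0).
  have va : cut v a !=set0 by apply: bv.1; rewrite (le_trans h0).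
  have vah : cut v (a - h) !=set0.
    by apply: bv.1; apply/andP; split; lra.
  apply: le_trans (hausdorff_dist_triangle _ _ _ ua va) _.
  by apply: leeD2l; exact: hausdorff_dist_triangle.
have -> : e = e / 3 + (e / 3 + e / 3) by field.
by rewrite !EFinD; apply: lteD => //; exact: lteD.
Qed.


(** Chebyshev's argument: the distance to the origin decreases with the level, so on [0, a] it is at
    least its value at a, and a^(1/p) times that value is at most M. *)
Lemma cut_norm_bound u (M a : R) : bounded_cuts u -> (dp p u fz <= M%:E)%E ->
  0 < a <= 1 -> (hd (cut u a) [set 0%R] <= (M / a `^ p^-1)%:E)%E.
Proof.
move=> bu uM /andP[a0 a1]; have bO := @bounded_cuts0 R m.
have f0 : finite_nonneg_on `[0, a]%classic (fun b => hd (cut u b) (cut fz b)).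
  exact: cuts_finite_nonneg.
have Da : (`[0, a]%classic : set R) a by rewrite /= in_itv/= lexx ltW.
have a01 : 0 <= a <= 1 by rewrite a1 ltW.
have [] := f0.2 _ Da; rewrite (fuzzy_cut0 _ a01) => h0 hfin.
rewrite -(fineK hfin) lee_fin ler_pdivlMr ?powR_gt0// -lee_fin.
rewrite -[X in (fine _ * X `^ _)%R]subr0 -pnorm_cst ?fine_ge0 ?(ltW a0)//.
apply: le_trans uM.
apply: (@le_trans _ _ (pnorm p `[0, a]%classic (fun b => hd (cut u b) (cut fz b)))).
  apply: le_pnorm => //; first by apply: finite_nonneg_on_cst; rewrite fine_ge0.
  move=> b /=; rewrite in_itv/= => /andP[b0 ba]; rewrite fineK//.
  rewrite fuzzy_cut0 ?b0 ?(le_trans ba)//; apply: hausdorff_dist_set1.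
    exact: bu.1.
  exact: fuzzy_cut_subset.
rewrite dpE; apply: le_pnorm_subset => //; last exact: cuts_finite_nonneg.
exact: itv_sub01.
Qed.

(* Left-continuity at step [tau] moves the mass of the low levels [0, h] to
   [tau, tau + h], where it is small because the cuts there are bounded. *)
Lemma low_levels_small u (M tau h t : R) : bounded_cuts u ->
  (dp p u fz <= M%:E)%E -> 0 <= M -> 0 < tau -> 0 <= h -> tau + h <= 1 ->
  (pnorm p `[tau, 1%R]%classic (fun a => hd (cut u a) (cut u (a - tau))) <= t%:E)%E ->
  M / tau `^ p^-1 * h `^ p^-1 <= t ->
  (pnorm p `[0%R, h]%classic (fun a => hd (cut u a) (cut fz a)) <= (t + t)%:E)%E.
Proof.
move=> bu uM M0 tau0 h0 th1 ut Mt; have bO := @bounded_cuts0 R m.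
set D := (`[tau, tau + h]%classic : set R).
have D1 a : D a -> tau <= a <= tau + h by rewrite /D /= in_itv.
have mD : measurable D by exact: measurable_itv.
have E0 : (`[tau - tau, tau + h - tau]%classic : set R) = `[0, h]%classic.
  by rewrite subrr [tau + h]addrC addrK.
have h1 : h <= 1 by apply: le_trans th1; rewrite lerDr ltW.
have fg : finite_nonneg_on `[tau - tau, tau + h - tau]%classic
    (fun a => hd (cut u a) (cut fz a)).
  by rewrite E0; exact: cuts_finite_nonneg.
rewrite -E0 -(pnorm_shift p tau (tau + h) tau _ fg) EFinD.
have fS : finite_nonneg_on D (fun a => hd (cut u (a - tau)) (cut fz (a - tau))).
  apply: cut_finite_nonneg => //; first exact: interval_is_interval.
  - by move=> a /D1/andP[? ?]; apply/andP; split; lra.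
  - by move=> a /D1/andP[? ?]; apply/andP; split; lra.
  - by move=> a b; rewrite lerD2r.
  - by move=> a b; rewrite lerD2r.
have fu : finite_nonneg_on D (fun a => hd (cut u a) (cut u (a - tau))).
  by apply: shifted_cuts_finite_nonneg; rewrite ?lexx ?(ltW tau0).
have f0 : finite_nonneg_on D (fun a => hd (cut u a) (cut fz a)).
  by apply: cuts_finite_nonneg; rewrite ?(ltW tau0).
(* At each level a, [u]_(a - tau) is compared with [u]_a, and [u]_a with the origin. *)
apply: le_trans (pnorm_triangle p p1 D _ _ _ mD fS fu f0 _) _.
  move=> a /D1/andP[ta ath].
  have at0 : 0 <= a - tau by rewrite subr_ge0.
  have a1 : a <= 1 by exact: le_trans th1.
  have a01 : 0 <= a <= 1 by rewrite a1 (le_trans (ltW tau0)).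
  have at1 : 0 <= a - tau <= 1 by apply/andP; split; lra.
  rewrite (fuzzy_cut0 _ a01) (fuzzy_cut0 _ at1) (hausdorff_distC (cut u a) (cut u _)).
  by apply: hausdorff_dist_triangle; exact: bu.1.
apply: leeD.
  apply: le_trans ut; apply: le_pnorm_subset => //.
    by apply: subset_itvl; rewrite bnd_simp.
  by apply: shifted_cuts_finite_nonneg; rewrite ?lexx ?(ltW tau0).
have K0 : 0 <= M / tau `^ p^-1 by rewrite divr_ge0// powR_ge0.
(* Levels in [D] are at least tau, so [cut_norm_bound] at tau bounds their cuts; [D] has length
   h. *)
apply: (@le_trans _ _ (pnorm p D (fun=> (M / tau `^ p^-1)%:E))).
  apply: le_pnorm => // a /D1/andP[ta ath]; have a1 : a <= 1 by exact: le_trans th1.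
  rewrite fuzzy_cut0; last by apply/andP; split; lra.
  apply: le_trans (cut_norm_bound _ M tau bu uM _); last by rewrite tau0; lra.
  apply: hausdorff_dist_set1; last by apply: fuzzy_cut_subset => //; exact: ltW.
  by apply: bu.1; apply/andP; split; lra.
by rewrite pnorm_cst ?lerDl// lee_fin [tau + h]addrC addrK.
Qed.

(** The 7 splits as 4 + 3. On [0, h] each of u and v is within 2t of [fuzzy0]. On [h, 1] the level a
    is rounded down to a grid level b: u from a to b, u to v at b, v from b back to a, each costing
    t. *)
Lemma dp_grid_close u v (M tau h t : R) (n : nat) :
  bounded_cuts u -> bounded_cuts v ->
  (dp p u fz <= M%:E)%E -> (dp p v fz <= M%:E)%E -> 0 <= M -> 0 < tau ->
  h = n.+1%:R^-1 -> tau + h <= 1 -> 0 <= t ->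
  M / tau `^ p^-1 * h `^ p^-1 <= t ->
  (pnorm p `[tau, 1%R]%classic (fun a => hd (cut u a) (cut u (a - tau))) <= t%:E)%E ->
  (pnorm p `[tau, 1%R]%classic (fun a => hd (cut v a) (cut v (a - tau))) <= t%:E)%E ->
  (pnorm p `[h, 1%R]%classic (fun a => hd (cut u a) (cut u (a - h))) <= t%:E)%E ->
  (pnorm p `[h, 1%R]%classic (fun a => hd (cut v a) (cut v (a - h))) <= t%:E)%E ->
  (forall j : nat, (0 < j <= n.+1)%N ->
    hd (cut u (j%:R / n.+1%:R)) (cut v (j%:R / n.+1%:R)) <= t%:E)%E ->
  (dp p u v <= (7%:R * t)%:E)%E.
Proof.
move=> bu bv uM vM M0 tau0 hn th1 t0 Mt ut vt uh vh uv.
have bO := @bounded_cuts0 R m.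
have h0 : 0 < h by rewrite hn invr_gt0.
have h1 : h <= 1 by apply: le_trans th1; rewrite lerDr ltW.
set E := (`[0, h]%classic : set R); set D := (`[h, 1]%classic : set R).
have E1 a : E a -> 0 <= a <= h by rewrite /E /= in_itv.
have D1 a : D a -> h <= a <= 1 by rewrite /D /= in_itv.
have mD : measurable D by exact: measurable_itv.
have mE : measurable E by exact: measurable_itv.
have U01 : I01 = E `|` D.
  apply/seteqP; split=> a /=; rewrite !in_itv/=.
    move=> /andP[a0 a1]; case: (leP a h) => [ah|/ltW ah]; [left|right];
      by apply/andP.
  by case=> [/E1|/D1] /andP[? ?]; apply/andP; split; lra.
have -> : 7%:R * t = ((t + t) + (t + t)) + (t + (t + t)) by ring.
rewrite dpE U01 EFinD; apply: le_trans (pnorm_setU p p1 E D _ mE mD _) _.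
  by rewrite -U01; exact: cuts_finite_nonneg.
have fuE : finite_nonneg_on E (fun a => hd (cut u a) (cut fz a)).
  exact: cuts_finite_nonneg.
have fvE : finite_nonneg_on E (fun a => hd (cut v a) (cut fz a)).
  exact: cuts_finite_nonneg.
apply: leeD.
  have uE := low_levels_small _ _ _ h _ bu uM M0 tau0 (ltW h0) th1 ut Mt.
  have vE := low_levels_small _ _ _ h _ bv vM M0 tau0 (ltW h0) th1 vt Mt.
  rewrite EFinD; apply: le_trans (leeD uE vE); apply: pnorm_triangle => //.
    exact: cuts_finite_nonneg.
  move=> a /E1/andP[a0 ah]; have a1 : a <= 1 by exact: le_trans h1.
  rewrite (hausdorff_distC (cut v a)); apply: hausdorff_dist_triangle.
    by apply: bu.1; rewrite a0.
  by apply: bO.1; rewrite a0.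
have fuD : finite_nonneg_on D (fun a => hd (cut u a) (cut u (a - h))).
  by apply: shifted_cuts_finite_nonneg; rewrite ?lexx ?(ltW h0).
have fvD : finite_nonneg_on D (fun a => hd (cut v a) (cut v (a - h))).
  by apply: shifted_cuts_finite_nonneg; rewrite ?lexx ?(ltW h0).
have ft : finite_nonneg_on D (fun=> t%:E) by exact: finite_nonneg_on_cst.
have ct : (pnorm p D (fun=> t%:E) <= t%:E)%E.
  rewrite pnorm_cst// lee_fin ler_piMr//.
  apply: (@le_trans _ _ (1 `^ p^-1)); last by rewrite powR1.
  rewrite ge0_ler_powR ?nnegrE ?invr_ge0 ?subr_ge0 ?(ltW p0)//.
  by rewrite gerBl ltW.
rewrite !EFinD; apply: le_trans (leeD uh (leeD ct vh)).
apply: le_trans; last by apply: leeD2l; exact: pnormD.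
apply: pnorm_triangle => //; first by apply: cuts_finite_nonneg; rewrite ?(ltW h0).
  exact: finite_nonneg_onD.
move=> a /D1/andP[ha a1]; have a0 : 0 <= a by rewrite (le_trans (ltW h0)).
pose j := Num.truncn (a * n.+1%:R).
have an0 : 0 <= a * n.+1%:R by rewrite mulr_ge0.
have /andP[ja aj] := truncn_itv an0.
have n0 : 0 < n.+1%:R :> R by [].
(* As a >= h, the grid level is positive; level 0, whose cuts (i) does not bound uniformly, is
   avoided. *)
have jgt0 : (0 < j)%N.
  by rewrite /j truncn_gt0 -ler_pdivrMr// mul1r -hn.
have jn : (j <= n.+1)%N.
  rewrite -ltnS /j truncn_lt_nat//.
  by apply: (@le_lt_trans _ _ n.+1%:R); rewrite ?ltr_nat// ler_piMl.
pose b : R := j%:R / n.+1%:R.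
have ba : b <= a by rewrite ler_pdivrMr.
have ahb : a - h <= b.
  rewrite lerBlDr hn /b -[X in _ + X]mul1r -mulrDl ler_pdivlMr// natr1.
  exact: ltW.
have b0 : 0 <= b by rewrite divr_ge0.
have ah0 : 0 <= a - h by rewrite subr_ge0.
(* As a - h <= b <= a, the cuts at a and b lie between those at a and a - h. *)
have nest w : bounded_cuts w ->
    (hd (cut w a) (cut w b) <= hd (cut w a) (cut w (a - h)))%E.
  move=> bw; apply: hausdorff_dist_nested => //; try exact: fuzzy_cut_subset.
  by apply: bw.1; rewrite a0.
have ne w c : bounded_cuts w -> 0 <= c -> c <= a -> cut w c !=set0.
  by move=> bw c0 ca; apply: bw.1; rewrite c0 (le_trans ca).
apply: le_trans (hausdorff_dist_triangle _ (cut u b) _ _ _) _; try exact: ne.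
apply: leeD; first exact: nest.
apply: le_trans (hausdorff_dist_triangle _ (cut v b) _ _ _) _; try exact: ne.
apply: leeD; first by apply: uv; rewrite jgt0.
by rewrite hausdorff_distC; exact: nest.
Qed.

Lemma p_mean_totally_bounded (U : set ('rV[R]_m -> R)) : U `<=` fuzzyB R m ->
  uniformly_p_mean_bounded p U -> p_mean_equi_left_continuous p U ->
  totally_bounded_in (fuzzyB R m) (dp p) U.
Proof.
(* Eight parts, since [dp_grid_close] costs seven and the bound must be strict. *)
move=> UB [M M0 UM] Uc e e0; pose t := e / 8%:R.
have t0 : 0 < t by rewrite divr_gt0.
have [d d0 Ud] := Uc _ t0.
(* Below d for (ii), and at most 1/2 so that tau + h <= 1 once h < tau. *)
pose tau := Num.min d 1 / 2.
have tau0 : 0 < tau by rewrite divr_gt0// lt_min d0 ltr01.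
have taud : tau < d.
  by rewrite /tau ltr_pdivrMr// gt_min; apply/orP; left; rewrite ltr_pMr// ltr1n.
have tau1 : tau <= 1 / 2 by rewrite ler_pM2r ?invr_gt0// ge_min lexx orbT.
(* [kappa] solves M / tau^(1/p) * kappa^(1/p) = t. *)
pose kappa := (t / (M / tau `^ p^-1)) `^ p.
have Mtau0 : 0 < M / tau `^ p^-1 by rewrite divr_gt0// powR_gt0.
have kappa0 : 0 < kappa by rewrite powR_gt0// divr_gt0.
pose x := Num.min tau kappa.
have x0 : 0 < x by rewrite lt_min tau0.
pose n := Num.truncn x^-1; pose h : R := n.+1%:R^-1.
have h0 : 0 < h by rewrite invr_gt0.
have hx : h < x.
  rewrite -[ltRHS]invrK ltf_pV2 ?posrE ?invr_gt0//; exact: truncnS_gt.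
have htau : h < tau by apply: lt_le_trans hx _; rewrite ge_min lexx.
have hkappa : h < kappa by apply: lt_le_trans hx _; rewrite ge_min lexx orbT.
have Mt : M / tau `^ p^-1 * h `^ p^-1 <= t.
  rewrite -ler_pdivlMl// mulrC.
  apply: (@le_trans _ _ (kappa `^ p^-1)).
    by rewrite ge0_ler_powR ?nnegrE ?invr_ge0 ?ltW.
  by rewrite /kappa -powRrM divff ?gt_eqF// powRr1// divr_ge0// ltW.
(* The cut at level h is within M / h^(1/p) of the origin; the 1 gives the strict inequality
   required in [hausdorff_leP]. *)
pose r := M / h `^ p^-1 + 1.
have [T [Q [_ Qclose]]] := @finite_cells R m r _ t0.
(* [f u] lists the cells met by the cuts at levels j/(n+1), j <= n+1; equal codes give close cuts
   for j > 0, where these lie in the box. *)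
pose f u : {ffun 'I_n.+2 -> {set T}} := [ffun j : 'I_n.+2 => Q (cut u (j%:R / n.+1%:R))].
have bU u : U u -> bounded_cuts u by move=> /UB/fuzzyB_bounded_cuts.
have h1 : h <= 1 by lra.
have boxU u j : U u -> (0 < j <= n.+1)%N -> cut u (j%:R / n.+1%:R) `<=` box r.
  move=> Uu /andP[j0 jn] y uy.
  have {}uy : cut u h y.
    move: uy; apply: fuzzy_cut_subset; first exact: ltW.
    by rewrite /h -[leLHS]mul1r ler_pM2r ?invr_gt0// ler1n.
  have /hausdorff_leP/(_ r)[|/(_ _ uy)[_ -> yr] _] :=
    cut_norm_bound _ _ h (bU _ Uu) (UM _ Uu) (introT andP (conj h0 h1)).
    by rewrite lte_fin ltrDl.
  move=> i; have := coord_le_euclidean_dist y 0 i.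
  by rewrite mxE subr0 => /le_trans; apply; exact: ltW.
have [F [finF FU UF]] : exists F : set ('rV[R]_m -> R),
    [/\ finite_set F, F `<=` U & forall u, U u -> exists2 v, F v & (dp p u v < e%:E)%E].
  apply: (@finite_net _ _ U f (fun u v => dp p u v < e%:E)%E) => u v Uu Uv /ffunP fuv.
  apply: (@le_lt_trans _ _ (7%:R * t)%:E); last first.
    by rewrite lte_fin /t mulrCA gtr_pMr// ltr_pdivrMr// mul1r ltr_nat.
  apply: (@dp_grid_close u v M tau h t n) => //; try exact: bU; try exact: UM;
    try (by apply: ltW; apply: Ud => //; rewrite ?(ltW tau0) ?(ltW h0) ?(lt_trans htau)).
  - exact: ltW.
  - lra.
  - exact: ltW.
  move=> j jn; apply: Qclose; try exact: boxU.
  have jn2 : (j < n.+2)%N by case/andP: jn.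
  by have := fuv (Ordinal jn2); rewrite !ffunE.
by exists F; split=> //; exact: subset_trans UB.
Qed.

End dp.

Theorem theorem5p4 (R : realType) (m : nat) (p : R)
    (U : set ('rV[R]_m -> R)) :
  (1 <= m)%N -> 1 <= p -> U `<=` fuzzyB R m ->
  totally_bounded_in (fuzzyB R m) (dp p) U <->
  uniformly_p_mean_bounded p U /\ p_mean_equi_left_continuous p U.
Proof.
move=> _ p1 UB; split=> [tbU|[Ub Uc]].
  split; first exact: totally_bounded_p_mean_bounded.
  exact: totally_bounded_equi_left_continuous.
exact: p_mean_totally_bounded.
Qed.
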